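(* Let $\mu$ be a discrete graphical model with true parameters $\underline\theta^*$ as described in the context, with finite maximum interaction strength $\gamma$. Fix a vertex $u\in\mathcal V$, a set of target factors $\mathcal T_u\subseteq\mathcal K_u$, a norm $\|\cdot\|$ on $\mathbb R^{\mathcal T_u}$, a number $\widehat\gamma>0$ and a constraint set $\mathcal Y_u\subseteq\mathbb R^{\mathcal K_u}$ such that $\|\underline\theta^*_u\|_1\le\widehat\gamma$ and $\underline\theta_u^*\in\mathcal Y_u$. Assume that there is a constant $\rho_u>0$ such that for every $\underline x$ in the perturbation set $\mathcal X_u=\{\underline y_1-\underline y_2 \mid \underline y_1,\underline y_2\in\mathcal Y_u,\ \|\underline y_1\|_1\le\widehat\gamma,\ \|\underline y_2\|_1\le\widehat\gamma\}$, $$\mathbb E\Big[\Big(\sum_{k\in\mathcal K_u}x_k\,g_{uk}(\underline\sigma_k)\Big)^2\Big]\ \ge\ \rho_u\,\|\underline x_{\mathcal T_u}\|^2 ,$$ where $\underline\sigma\sim\mu$ and $\underline x_{\mathcal T_u}=(x_k)_{k\in\mathcal T_u}$. Let $\alpha>0$ and $\delta\in(0,1)$, and let $\underline\sigma^{(1)},\dots,\underline\sigma^{(n)}$ be i.i.d. samples from $\mu$ with $$n\ \ge\ 2^{14}\,\frac{\widehat\gamma^2(1+\widehat\gamma)^2e^{4\gamma}}{\alpha^4\rho_u^2}\,\log\Big(\frac{4\mathbf K_u^2}{\delta}\Big).$$ Then with probability at least $1-\delta$ the following holds: for every $\epsilon\le \dfrac{\rho_u\alpha^2e^{-\gamma}}{20(1+\widehat\gamma)}$,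 every $\epsilon$-minimizer $\widehat{\underline\theta}_u$ of GRISE (see context) satisfies $$\|\widehat{\underline\theta}_{\mathcal T_u}-\underline\theta^*_{\mathcal T_u}\|\le\frac{\alpha}{2}.$$
   Context: Model. $\mathcal V=\{1,\dots,p\}$; each variable $\sigma_i$ takes values in a finite nonempty alphabet $\mathcal A_i$. $\mathcal K$ is a finite set of factors; each $k\in\mathcal K$ comes with a nonempty set of vertices $\partial k\subseteq\mathcal V$ and a basis function $f_k$ which is a real function of $\underline\sigma_k=(\sigma_j)_{j\in\partial k}$. The model is the probability distribution $\mu(\underline\sigma)=\frac1Z\exp\big(\sum_{k\in\mathcal K}\theta^*_kf_k(\underline\sigma_k)\big)$ on $\prod_i\mathcal A_i$, with real parameters $\theta_k^*$ and normalizing constant $Z$. For $i\in\mathcal V$: $\mathcal K_i=\{k\in\mathcal K\mid i\in\partial k\}$, $\mathbf K_i=|\mathcal K_i|$, $\underline\theta_i=(\theta_k)_{k\in\mathcal K_i}$. Locally centered basis functions. For $k\in\mathcal K_i$, $g_{ik}(\underline\sigma_k)=f_k(\underline\sigma_k)-\frac1{|\mathcal A_i|}\sum_{\sigma_i\in\mathcal A_i}f_k(\underline\sigma_k)$. Standing normalization assumption: $\max_{\underline\sigma_k}|g_{ik}(\underline\sigma_k)|\le1$ for all $i\in\mathcal V$, $k\in\mathcal K_i$. Maximum interaction strength: $\gamma=\max_{i\in\mathcal V}\max_{\underline\sigma}\big|\sum_{k\in\mathcal K_i}\theta^*_kg_{ik}(\underline\sigma_k)\big|$. GRISE. The generalized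 interaction screening objective at vertex $u$ is $\mathcal S_n(\underline\theta_u)=\frac1n\sum_{t=1}^n\exp\big(-\sum_{k\in\mathcal K_u}\theta_kg_{uk}(\underline\sigma^{(t)}_k)\big)$ for $\underline\theta_u\in\mathbb R^{\mathcal K_u}$. An $\epsilon$-minimizer of GRISE is a point $\widehat{\underline\theta}_u\in\mathcal Y_u$ with $\|\widehat{\underline\theta}_u\|_1\le\widehat\gamma$ such that $\mathcal S_n(\widehat{\underline\theta}_u)\le\mathcal S_n(\underline\theta_u)+\epsilon$ for all $\underline\theta_u\in\mathcal Y_u$ with $\|\underline\theta_u\|_1\le\widehat\gamma$. *)

(* Defs.v *)
(* MathComp / MathComp-Analysis. *)
From mathcomp Require Import all_boot all_order all_algebra.
From mathcomp Require Import all_classical all_reals all_analysis.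

Set Implicit Arguments.
Unset Strict Implicit.
Unset Printing Implicit Defensive.

Import Order.TTheory GRing.Theory Num.Theory.

Local Open Scope classical_set_scope.
Local Open Scope ring_scope.

(* Assignments of the variables in S; each basis function has such a dependent
   product as its domain, so it can only depend on the variables in S. *)
Definition local_config (p : nat) (A : 'I_p -> finType) (S : {set 'I_p}) :=
  {dffun forall j : {j : 'I_p | j \in S}, A (val j)}.

(* Vertices are 'I_p, i.e. numbered from 0. The parameters theta^* of the
   distribution are part of the model. *)
Record graphical_model (R : realType) (p : nat) := GraphicalModel {
  alphabet : 'I_p -> finType ;
  alphabet_gt0 : forall i, (0 < #|alphabet i|)%N ;
  gfactor : finType ;
  boundary : gfactor -> {set 'I_p} ;
  boundary_neq0 : forall k, boundary k != finset.set0 ;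
  basis : forall k : gfactor, local_config alphabet (boundary k) -> R ;
  theta_star : gfactor -> R }.

Section Model.
Context {R : realType} {p : nat} (M : graphical_model R p).

Definition config := {dffun forall i : 'I_p, alphabet M i}.

Definition restrict_to (k : gfactor M) (s : config) :
    local_config (alphabet M) (boundary k) :=
  [ffun j : {j : 'I_p | j \in boundary k} => s (val j)].

Definition weight (s : config) : R :=
  expR (\sum_(k : gfactor M) theta_star k * basis (restrict_to k s)).

Definition partition_function : R := \sum_(s : config) weight s.

Definition gibbs (s : config) : R := weight s / partition_function.

Definition gibbs_mean (h : config -> R) : R := \sum_(s : config) gibbs s * h s.

Definition factors_at (i : 'I_p) := {k : gfactor M | i \in boundary k}.

(* Sets the i-th coordinate to a. *)
Definition update (i : 'I_p) (k : factors_at i)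
    (sk : local_config (alphabet M) (boundary (val k))) (a : alphabet M i) :
    local_config (alphabet M) (boundary (val k)) :=
  [ffun j => @eqtype.dfwith _ (fun j => alphabet M (val j)) sk
               (exist _ i (valP k)) a j].

Definition centered (i : 'I_p) (k : factors_at i)
    (sk : local_config (alphabet M) (boundary (val k))) : R :=
  basis sk - #|alphabet M i|%:R^-1 * \sum_(a : alphabet M i) basis (update sk a).

Definition normalized : Prop :=
  forall (i : 'I_p) (k : factors_at i)
    (sk : local_config (alphabet M) (boundary (val k))),
  `|centered sk| <= 1.

(* For p > 0 the maxima are over nonempty sets of nonnegative numbers, so the
   default value 0 is harmless. *)
Definition interaction_strength : R :=
  \big[Num.max/0]_(i : 'I_p) \big[Num.max/0]_(s : config)
    `|\sum_(k : factors_at i) theta_star (val k) * centered (restrict_to (val k) s)|.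

Section Vertex.
Variable u : 'I_p.

Definition theta_star_at : {ffun factors_at u -> R^o} :=
  [ffun k => theta_star (val k)].

Definition local_energy (x : {ffun factors_at u -> R^o}) (s : config) : R :=
  \sum_(k : factors_at u) x k * centered (restrict_to (val k) s).

Definition GISO (n : nat) (smp : 'I_n -> config)
    (x : {ffun factors_at u -> R^o}) : R :=
  n%:R^-1 * \sum_(t < n) expR (- local_energy x (smp t)).

End Vertex.
End Model.

Definition norm1 {R : realType} {I : finType} (x : {ffun I -> R^o}) : R :=
  \sum_(i : I) `|x i|.

(* Nonnegativity follows from these three properties. *)
Definition is_norm {R : realType} {I : finType} (N : {ffun I -> R^o} -> R) : Prop :=
  [/\ forall x y, N (x + y) <= N x + N y,
      forall (a : R) x, N (a *: x) = `|a| * N x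
    & forall x, N x = 0 -> x = 0].

Definition subvec {R : realType} {I : finType} (T : {set I})
    (x : {ffun I -> R^o}) : {ffun {i : I | i \in T} -> R^o} :=
  [ffun i => x (val i)].

Definition perturbation_set {R : realType} {I : finType} (ghat : R)
    (Y : set {ffun I -> R^o}) : set {ffun I -> R^o} :=
  [set x | exists y1 y2, [/\ Y y1, Y y2, norm1 y1 <= ghat, norm1 y2 <= ghat
                           & x = y1 - y2]].

Definition eps_minimizer {R : realType} {p : nat} (M : graphical_model R p)
    (u : 'I_p) (n : nat) (smp : 'I_n -> config M) (ghat : R)
    (Y : set {ffun factors_at M u -> R^o}) (eps : R)
    (x : {ffun factors_at M u -> R^o}) : Prop :=
  [/\ Y x, norm1 x <= ghat
    & forall y, Y y -> norm1 y <= ghat -> GISO smp x <= GISO smp y + eps].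

(* The samples take values in a finite set with its discrete sigma-algebra, so
   measurability and the law are stated on singletons. Taking some of the A t
   equal to [set: config M] gives the product rule for every subfamily. *)
Definition iid_samples {R : realType} {p : nat} (M : graphical_model R p)
    {d : measure_display} {Omega : measurableType d} (P : probability Omega R)
    (n : nat) (X : 'I_n -> Omega -> config M) : Prop :=
  [/\ forall t s, measurable (X t @^-1` [set s]),
      forall t s, P (X t @^-1` [set s]) = (gibbs s)%:E
    & forall A : 'I_n -> set (config M),
        P (\bigcap_t (X t @^-1` A t)) = (\prod_(t < n) P (X t @^-1` A t))%E].

(* Main.v *)
(* The screening objective is chosen so that every entry
   [- g_k e^(- E_0)] of its gradient at the true parameters [theta_0] has mean
   zero, where [E_0] is the local energy: multiplying the Gibbs weight by
   [e^(- E_0)] removes its dependence on [sigma_u], and [g_k] sums to zero over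
   [sigma_u].  By Hoeffding's inequality and a union bound, with probability at
   least [1 - delta] all empirical gradient entries are small and all empirical
   means of [g_k g_l] are close to their expectations.  On that event,
   [e^(- z) - 1 + z >= z^2 / (2 + |z|)] bounds the increase of the objective from
   [theta_0] to [theta_0 + Delta] below by a small linear term plus a multiple of
   the empirical mean of [E_Delta^2], hence by a multiple of [rho ||Delta_T||^2]
   up to a small error; so an epsilon-minimizer is close to [theta_0] on the
   target factors. *)
Require Import Defs.
From mathcomp Require Import all_boot all_order all_algebra.
From mathcomp Require Import all_classical all_reals all_analysis.
From mathcomp Require Import ring lra.

Set Implicit Arguments.
Unset Strict Implicit.
Unset Printing Implicit Defensive.

Import Order.TTheory GRing.Theory Num.Theory.
Import numFieldNormedType.Exports.

Local Open Scope classical_set_scope.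
Local Open Scope ring_scope.

(** * Inequalities for the exponential *)

(** Mean value theorem on [0, x]; below it is applied to functions whose value at 0 is explicit. *)
Lemma ge0_derive_le (R : realType) (f f' : R -> R)
    (df : forall x : R, is_derive x 1 f (f' x))
    (f'_ge0 : forall x, 0 < x -> 0 <= f' x) (x : R) :
  0 <= x -> f 0 <= f x.
Proof.
rewrite le_eqVlt => /predU1P[<-//|x0].
have [|c] := MVT x0 (fun y _ => df y).
  apply: continuous_subspaceT => y.
  by apply: differentiable_continuous; apply/derivable1_diffP; have [] := df y.
rewrite in_itv /= => /andP[c0 _] fx.
by rewrite -subr_ge0 fx mulr_ge0 ?f'_ge0// subr0 ltW.
Qed.

(** The case z = x >= 0 of [expRN_taylor_ge] with its denominator cleared. The derivative 1 - (1 +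
    y) e^(- y) is nonnegative because e^y >= 1 + y. *)
Lemma mul2D_expRN_ge (R : realType) (x : R) :
  0 <= x -> 2 <= (2 + x) * expR (- x) + x.
Proof.
set f := fun x : R => (2 + x) * expR (- x) + x.
suff df (y : R) : is_derive y 1 f (1 - (1 + y) * expR (- y)).
  move=> x0; have /(_ _ _ x0) := ge0_derive_le df.
  rewrite /f oppr0 expR0 !addr0 mulr1; apply => y _.
  by rewrite expRN subr_ge0 ler_pdivrMr ?expR_gt0// mul1r expR_ge1Dx.
apply: is_derive_eq.
rewrite /GRing.scale /=; ring.
Qed.

(** The case z = - x <= 0 of [expRN_taylor_ge] with its denominator cleared. *)
Lemma mul2D_expR_ge (R : realType) (x : R) :
  0 <= x -> 2 + 3 * x + 2 * x ^+ 2 <= (2 + x) * expR x.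
Proof.
set f := fun x : R => (2 + x) * expR x - (3 * x + 2 * x ^+ 2).
suff df (y : R) : is_derive y 1 f ((3 + y) * expR y - (3 + 4 * y)).
  move=> x0; have /(_ _ _ x0) := ge0_derive_le df.
  suff fge (y : R) : 0 < y -> 0 <= (3 + y) * expR y - (3 + 4 * y).
    by move/(_ fge); rewrite /f expR0; lra.
  (* By e^y >= 1 + y the derivative is at least (3 + y)(1 + y) - (3 + 4y) = y^2. *)
  by move=> y0; have := expR_ge1Dx y; nra.
apply: is_derive_eq.
rewrite /GRing.scale /=; ring.
Qed.

Lemma expRN_taylor_ge (R : realType) (z : R) :
  z ^+ 2 / (2 + `|z|) <= expR (- z) - 1 + z.
Proof.
rewrite ler_pdivrMr; last by have := normr_ge0 z; lra.
have [z0|z0] := ger0P z.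
  by have := mul2D_expRN_ge z0; lra.
have /mul2D_expR_ge : 0 <= - z by lra.
by lra.
Qed.

(** * Hoeffding's lemma for a two-point law *)

Section HoeffdingLemma.
Context {R : realType} (m : R).
Hypothesis m_le1 : `|m| <= 1.

(* Moment generating function of the law on {-1, 1} with mean m. *)
Let D (x : R) := (1 + m) / 2 * expR x + (1 - m) / 2 * expR (- x).
Let D' (x : R) := (1 + m) / 2 * expR x - (1 - m) / 2 * expR (- x).

Let D_gt0 x : 0 < D x.
Proof.
move: m_le1; rewrite ler_norml => /andP[m1 m2].
have := expR_gt0 x; have := expR_gt0 (- x); rewrite /D; nra.
Qed.

Let D_derive (x : R) : is_derive x 1 D (D' x).
Proof. by apply: is_derive_eq; rewrite /D' /GRing.scale /=; ring. Qed.

Let D'_derive (x : R) : is_derive x 1 D' (D x).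
Proof. by apply: is_derive_eq; rewrite /D /GRing.scale /=; ring. Qed.

(* [D' / D] has derivative [1 - (D' / D)^2 <= 1]. *)
Let D'_le (x : R) : 0 <= x -> D' x <= (m + x) * D x.
Proof.
move=> x0; rewrite -ler_pdivrMr ?D_gt0//.
set f := fun x : R => x - D' x * (D x)^-1.
have df (y : R) : is_derive y 1 f ((D' y / D y) ^+ 2).
  have Dy0 : D y != 0 by rewrite gt_eqF.
  have dV : is_derive y 1 (fun y => (D y)^-1) (- (D y) ^- 2 *: D' y).
    exact: is_deriveV.
  apply: is_derive_eq.
  rewrite /GRing.scale /= mulrN1 mulrN opprK -[(1 + m) / 2 * _ + _]/(D y).
  by field.
have /(_ _ x0) := ge0_derive_le df (fun y _ => sqr_ge0 _).
have -> : f 0 = - m.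
  rewrite /f /D /D' oppr0 expR0; field; nra.
by rewrite /f; lra.
Qed.

(** [D'_le] bounds the derivative of ln D by m + x, and ln D vanishes at 0. The proof avoids the
    logarithm by showing that D(x) e^(- (m x + x^2 / 2)) does not increase. *)
Lemma hoeffding_two_point (x : R) : 0 <= x ->
  (1 + m) / 2 * expR x + (1 - m) / 2 * expR (- x) <= expR (m * x + x ^+ 2 / 2).
Proof.
move=> x0.
set f := fun x : R => - (D x * expR (- (m * x + x ^+ 2 / 2))).
have df (y : R) : is_derive y 1 f
    (((m + y) * D y - D' y) * expR (- (m * y + y ^+ 2 / 2))).
  by apply: is_derive_eq; rewrite /GRing.scale /D /D' /=; field.
have := ge0_derive_le df.
have fge y : 0 < y ->
    0 <= ((m + y) * D y - D' y) * expR (- (m * y + y ^+ 2 / 2)).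
  by move=> y0; rewrite mulr_ge0 ?expR_ge0// subr_ge0 D'_le// ltW.
have D0 : D 0 * expR (- (m * 0 + 0 ^+ 2 / 2)) = 1.
  by rewrite /D mulr0 expr0n /= mul0r addr0 oppr0 expR0; field.
move=> /(_ fge _ x0); rewrite /f lerN2 D0 [X in D x * X]expRN.
by rewrite ler_pdivrMr ?expR_gt0// mul1r.
Qed.

End HoeffdingLemma.

(** * Hoeffding's inequality for samples from a finite law *)

Definition empirical_mean (R : realType) (S : Type) (n : nat) (b : 'I_n -> S)
    (h : S -> R) : R :=
  n%:R^-1 * \sum_(t < n) h (b t).

Section FiniteHoeffding.
Context {R : realType} {S : finType} (q : S -> R).
Hypothesis q_ge0 : forall s, 0 <= q s.
Hypothesis q_sum1 : \sum_s q s = 1.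

Let mean (h : S -> R) : R := \sum_s q s * h s.

(** Convexity of exp: spreading each value of [h] onto -1 and 1 with the same mean can only increase
    the left side, and yields the two-point law with mean [mean h]. *)
Let hoeffding_mgf (h : S -> R) (x : R) : (forall s, `|h s| <= 1) -> 0 <= x ->
  mean (fun s => expR (x * h s)) <= expR (mean h * x + x ^+ 2 / 2).
Proof.
move=> h1 x0.
have mean_le1 : `|mean h| <= 1.
  rewrite -q_sum1; apply: le_trans (ler_norm_sum _ _ _) _.
  by apply: ler_sum => s _; rewrite normrM (ger0_norm (q_ge0 s)) ler_piMr.
apply: le_trans (hoeffding_two_point mean_le1 x0).
(* Both exponentials on the right lie above the tangent of exp at [x * h s]. *)
have chord s : expR (x * h s) <=
    (1 + h s) / 2 * expR x + (1 - h s) / 2 * expR (- x).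
  have tangent y : expR (x * h s) * (1 + (y - x * h s)) <= expR y.
    rewrite -[in leRHS](subrK (x * h s) y) expRD mulrC.
    by rewrite ler_pM2r ?expR_gt0// expR_ge1Dx.
  have := tangent x; have := tangent (- x); have := h1 s.
  by rewrite ler_norml => /andP[]; nra.
apply: le_trans (ler_sum _ (fun s _ => ler_wpM2l (q_ge0 s) (chord s))) _.
have -> : \sum_s q s * ((1 + h s) / 2 * expR x + (1 - h s) / 2 * expR (- x)) =
    \sum_s (q s * ((expR x + expR (- x)) / 2) +
            q s * h s * ((expR x - expR (- x)) / 2)).
  by apply: eq_bigr => s _; field.
rewrite big_split /= -!mulr_suml q_sum1 -/(mean h).
by lra.
Qed.

(** Chernoff's method with parameter e, which minimizes the exponent x^2 / 2 - x e per sample. *)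
Let upper_tail (n : nat) (h : S -> R) (e : R) :
    (forall s, `|h s| <= 1) -> 0 <= e ->
  \sum_(b : {ffun 'I_n -> S} | n%:R * e <= \sum_(t < n) (h (b t) - mean h))
     \prod_(t < n) q (b t) <= expR (- (n%:R * e ^+ 2 / 2)).
Proof.
move=> h1 e0.
(* On the tail event the exponents of the tilting factors sum to a nonnegative number, so their
   product is at least 1 and dominates the indicator. *)
pose F s := q s * expR (e * (h s - mean h - e)).
have F0 s : 0 <= F s by rewrite mulr_ge0 ?expR_ge0.
apply: (@le_trans _ _ (\sum_(b : {ffun 'I_n -> S}) \prod_(t < n) F (b t))).
  rewrite [leRHS](bigID (fun b : {ffun 'I_n -> S} =>
    n%:R * e <= \sum_(t < n) (h (b t) - mean h))) /=.
  rewrite -[leLHS]addr0; apply: lerD; last first.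
    by apply: sumr_ge0 => b _; apply: prodr_ge0.
  apply: ler_sum => b hb; rewrite big_split /= ler_peMr ?prodr_ge0//.
  rewrite -expR_sum -mulr_sumr -[1]expR0 ler_expR mulr_ge0//.
  rewrite sumrB sumr_const card_ord subr_ge0.
  by rewrite -mulr_natl.
(* The sum over all samples factorizes into the n-th power of a sum over one coordinate. *)
rewrite -(bigA_distr_bigA (fun=> F)) /= prodr_const card_ord.
have -> : - (n%:R * e ^+ 2 / 2) = n%:R * (- (e ^+ 2 / 2)) by field.
rewrite expRM_natl lerXn2r// ?nnegrE ?expR_ge0//; first exact: sumr_ge0.
have -> : \sum_s F s =
    expR (- (e * mean h + e ^+ 2)) * mean (fun s => expR (e * h s)).
  rewrite mulr_sumr; apply: eq_bigr => s _; rewrite mulrCA -expRD.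
  by congr (_ * expR _); ring.
apply: le_trans (ler_wpM2l (expR_ge0 _) (hoeffding_mgf h1 e0)) _.
by rewrite -expRD ler_expR; lra.
Qed.

(** [upper_tail] is applied to h / c and to - h / c, whence the factor 2; e is a deviation relative
    to the range c. *)
Lemma hoeffding (n : nat) (h : S -> R) (c e : R) :
    (0 < n)%N -> 0 < c -> (forall s, `|h s| <= c) -> 0 <= e ->
  \sum_(b : {ffun 'I_n -> S} |
        c * e < `|empirical_mean b h - \sum_s q s * h s|)
     \prod_(t < n) q (b t) <= 2 * expR (- (n%:R * e ^+ 2 / 2)).
Proof.
move=> n0 c0 hc e0.
have nR0 : 0 < n%:R :> R by rewrite ltr0n.
have tail (g : S -> R) := @upper_tail n (fun s => g s / c) e.
have gc (g : S -> R) : (forall s, `|g s| <= c) -> forall s, `|g s / c| <= 1.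
  by move=> hg s; rewrite normrM normfV (gtr0_norm c0) ler_pdivrMr// mul1r.
have h1 := tail _ (gc _ hc) e0.
have hNc s : `|- h s| <= c by rewrite normrN.
have h2 := tail _ (gc (fun s => - h s) hNc) e0.
rewrite mulrDl mul1r; apply: le_trans (lerD h1 h2).
have prodq (b : {ffun 'I_n -> S}) : 0 <= \prod_(t < n) q (b t).
  by apply: prodr_ge0.
rewrite big_mkcond [X in _ <= X + _]big_mkcond [X in _ <= _ + X]big_mkcond.
rewrite -big_split /=; apply: ler_sum => b _.
case: ifPn => [hb|_]; last by case: ifPn; case: ifPn; rewrite ?addr0 ?addr_ge0.
have centre (g : S -> R) : \sum_(t < n) (g (b t) / c - mean (fun s => g s / c)) =
    n%:R / c * (empirical_mean b g - \sum_s q s * g s).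
  have -> : mean (fun s => g s / c) = (\sum_s q s * g s) / c.
    by rewrite mulr_suml; apply: eq_bigr => s _; rewrite mulrA.
  rewrite sumrB sumr_const card_ord -mulr_suml -mulr_natl /empirical_mean; field.
  by rewrite !gt_eqF.
rewrite !centre.
have -> : empirical_mean b (fun s => - h s) = - empirical_mean b h.
  by rewrite /empirical_mean sumrN mulrN.
have -> : \sum_s q s * - h s = - (\sum_s q s * h s).
  by rewrite -sumrN; apply: eq_bigr => s _; rewrite mulrN.
have thr z : c * e <= z -> n%:R * e <= n%:R / c * z.
  by move=> cz; rewrite -mulrA ler_pM2l// ler_pdivlMl.
move: hb; rewrite lter_normr => /orP[] /ltW hb.
  by rewrite (thr _ hb); case: ifPn; rewrite ?addr0 ?lerDl.
rewrite [X in _ + (if X then _ else _)]thr; first by case: ifPn; rewrite ?add0r ?lerDr.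
by rewrite opprK addrC -opprB.
Qed.

(** Each statistic keeps its own range, but the relative accuracy is common, so all terms of the
    union bound are equal. *)
Lemma hoeffding_union (I : finType) (n : nat) (h : I -> S -> R) (c : I -> R)
    (e : R) :
    (0 < n)%N -> (forall i, 0 < c i) -> (forall i s, `|h i s| <= c i) -> 0 <= e ->
  \sum_(b : {ffun 'I_n -> S} |
        [exists i, c i * e < `|empirical_mean b (h i) - \sum_s q s * h i s|])
     \prod_(t < n) q (b t) <= #|I|%:R * (2 * expR (- (n%:R * e ^+ 2 / 2))).
Proof.
move=> n0 c0 hc e0; rewrite mulr_natl -sumr_const.
apply: le_trans (ler_sum _ (fun i _ => hoeffding n0 (c0 i) (hc i) e0)).
under [leRHS]eq_bigr do rewrite big_mkcond.
rewrite big_mkcond [leRHS]exchange_big /=; apply: ler_sum => b _.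
have prodq : 0 <= \prod_(t < n) q (b t) by apply: prodr_ge0.
have if_ge0 (B : bool) : 0 <= (if B then \prod_(t < n) q (b t) else 0).
  by case: B; rewrite ?lexx.
case: ifPn => [/existsP[i hi]|_]; last first.
  by apply: sumr_ge0 => i _; exact: if_ge0.
by rewrite (bigD1 i)//= hi lerDl; apply: sumr_ge0 => j _; exact: if_ge0.
Qed.

End FiniteHoeffding.

(** Any event that depends only on the samples is a finite disjoint union of events fixing all
    sample values. It is therefore measurable, and its probability becomes a finite sum to which the
    bounds above apply. *)
Lemma prob_iid_samples {R : realType} {p : nat} (M : graphical_model R p)
    {d : measure_display} {Omega : measurableType d} (P : probability Omega R)
    (n : nat) (X : 'I_n -> Omega -> config M) (B : ('I_n -> config M) -> Prop) :
    iid_samples P X ->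
  P [set w | B (X^~ w)] =
  (\sum_(b : {ffun 'I_n -> config M} | `[< B b >]) \prod_(t < n) gibbs (b t))%:E.
Proof.
move=> [mX lawX indepX].
pose F (b : {ffun 'I_n -> config M}) := \bigcap_t (X t @^-1` [set b t]).
have -> : [set w | B (X^~ w)] =
    \bigcup_(b in [set b : {ffun 'I_n -> config M} | B b]) F b.
  apply/seteqP; split => [w /= Bw|w /= [b Bb Fb]].
    exists [ffun t => X t w].
      rewrite /=; suff -> : ([ffun t => X t w] : 'I_n -> config M) = X^~ w by [].
      by apply/funext => t; rewrite ffunE.
    by move=> t _ /=; rewrite ffunE.
  suff -> : X^~ w = b by [].
  by apply/funext => t; exact: (Fb t).
rewrite measure_fin_bigcup; first last.
- by move=> b _; apply: fin_bigcap_measurable => // t _; exact: mX.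
- move=> b b' _ _ [w [wb wb']]; apply/ffunP => t.
  by rewrite -(wb t I) -(wb' t I).
- exact: finite_finset.
rewrite (fsbigE (enum [pred b : {ffun 'I_n -> config M} | `[< B b >]])).
- rewrite big_enum_cond /= -sumEFin.
  apply: eq_big => b; first exact: andbb.
  move=> _; rewrite /F (indepX (fun t => [set b t])) -prodEFin.
  by apply: eq_bigr => t _; exact: lawX.
- exact: enum_uniq.
- by move=> b /=; rewrite mem_enum inE.
- by move=> b /= Bb; rewrite mem_enum inE (introT (asboolP _) Bb).
Qed.

(** * Gibbs distributions and the screening gradient *)

Section Gibbs.
Context {R : realType} {p : nat} (M : graphical_model R p).

Definition set_at (u : 'I_p) (s : config M) (a : alphabet M u) : config M :=
  [ffun j => @eqtype.dfwith _ (alphabet M) s u a j].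

Lemma card_config_gt0 : (0 < #|{: config M}|)%N.
Proof.
apply/card_gt0P; pose a i : alphabet M i := enum_val (Ordinal (alphabet_gt0 M i)).
by exists [ffun i => a i].
Qed.

Lemma weight_gt0 (s : config M) : 0 < weight s.
Proof. exact: expR_gt0. Qed.

Lemma partition_function_gt0 : 0 < partition_function M.
Proof.
have /card_gt0P[s _] := card_config_gt0.
rewrite /partition_function (bigD1 s)//= ltr_pwDl ?weight_gt0//.
by apply: sumr_ge0 => s' _; exact/ltW/weight_gt0.
Qed.

Lemma gibbs_ge0 (s : config M) : 0 <= gibbs s.
Proof. by rewrite divr_ge0// ltW ?weight_gt0 ?partition_function_gt0. Qed.

Lemma sum_gibbs : \sum_(s : config M) gibbs s = 1.
Proof. by rewrite -mulr_suml divff// gt_eqF// partition_function_gt0. Qed.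

Variable u : 'I_p.

Lemma set_atK (s : config M) (a : alphabet M u) : set_at (set_at s a) (s u) = s.
Proof.
apply/ffunP => j; rewrite !ffunE; case: eqtype.dfwithP => // {}j uj.
by rewrite ffunE eqtype.dfwith_out.
Qed.

Lemma set_at_in (s : config M) (a : alphabet M u) : set_at s a u = a.
Proof. by rewrite ffunE eqtype.dfwith_in. Qed.

Lemma restrict_set_at (k : factors_at M u) (s : config M) (a : alphabet M u) :
  restrict_to (val k) (set_at s a) = update (restrict_to (val k) s) a.
Proof.
apply/ffunP => j; rewrite !ffunE.
have [uj|uj] := eqVneq u (val j).
  have -> : j = exist _ u (valP k) by apply: val_inj.
  by rewrite /= !eqtype.dfwith_in.
by rewrite !eqtype.dfwith_out ?ffunE.
Qed.

Lemma restrict_set_at_out (k : gfactor M) (s : config M) (a : alphabet M u) :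
  u \notin boundary k -> restrict_to k (set_at s a) = restrict_to k s.
Proof.
move=> uk; apply/ffunP => j; rewrite !ffunE eqtype.dfwith_out//.
by apply: contra uk => /eqP ->; exact: valP.
Qed.

Lemma update_update (k : factors_at M u)
    (sk : local_config (alphabet M) (boundary (val k))) (a b : alphabet M u) :
  update (update sk a) b = update sk b.
Proof.
apply/ffunP => j; rewrite !ffunE.
have [<-|ij] := eqVneq (exist _ u (valP k)) j; first by rewrite !eqtype.dfwith_in.
by rewrite !eqtype.dfwith_out// ffunE eqtype.dfwith_out.
Qed.

Lemma alphabet_card_neq0 : #|alphabet M u|%:R != 0 :> R.
Proof. by rewrite pnatr_eq0 -lt0n alphabet_gt0. Qed.

(** The average subtracted in [centered] is unchanged by an update at u, so over all a it adds up to
    the sum of the basis function. *)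
Lemma sum_centered_set_at (k : factors_at M u) (s : config M) :
  \sum_(a : alphabet M u) centered (restrict_to (val k) (set_at s a)) = 0.
Proof.
rewrite /centered sumrB -mulr_sumr.
under eq_bigr do rewrite restrict_set_at.
under [X in _ - _ * X]eq_bigr => a _.
  under eq_bigr do rewrite restrict_set_at update_update.
  over.
by rewrite sumr_const -[X in _ * X]mulr_natl mulKf ?alphabet_card_neq0// subrr.
Qed.

(** The map (s, a) -> (set_at s a, s u) is an involution; reindexing by it leaves a summand free of
    a. *)
Lemma sum_set_at (H : config M -> R) :
  \sum_s \sum_(a : alphabet M u) H (set_at s a) = #|alphabet M u|%:R * \sum_s H s.
Proof.
rewrite pair_bigA /=.
have inj : injective (fun x : config M * alphabet M u => (set_at x.1 x.2, x.1 u)).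
  by apply: (can_inj (g := fun x => (set_at x.1 x.2, x.1 u))) => -[s a] /=;
    rewrite set_atK set_at_in.
rewrite (reindex_inj inj) /=.
under eq_bigr do rewrite set_atK.
rewrite -(pair_bigA _ (fun s _ => H s)) /= mulr_sumr.
by apply: eq_bigr => s _; rewrite sumr_const mulr_natl.
Qed.

(* Subtracting the local energy leaves only terms that do not depend on
   [sigma_u]: the factors away from [u] and the averages over [sigma_u]. *)
Lemma weight_screened_set_at (s : config M) (a : alphabet M u) :
  weight (set_at s a) * expR (- local_energy (theta_star_at M u) (set_at s a)) =
  weight s * expR (- local_energy (theta_star_at M u) s).
Proof.
rewrite /weight -!expRD; congr expR.
have splitE (t : config M) :
    \sum_(k : gfactor M) theta_star k * Defs.basis (restrict_to k t) -
      local_energy (theta_star_at M u) t =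
    \sum_(k : factors_at M u) theta_star (val k) *
      (#|alphabet M u|%:R^-1 *
       \sum_(b : alphabet M u) Defs.basis (update (restrict_to (val k) t) b)) +
    \sum_(k | u \notin boundary k) theta_star k * Defs.basis (restrict_to k t).
  rewrite (bigID (fun k => u \in boundary k)) /= addrAC; congr (_ + _).
  rewrite (big_sub [pred k | u \in boundary k]) /local_energy -sumrB.
  by apply: eq_bigr => k _; rewrite ffunE /centered -mulrBr opprB addrC subrK.
rewrite !splitE; congr (_ + _).
  apply: eq_bigr => k _; congr (_ * (_ * _)).
  by apply: eq_bigr => b _; rewrite restrict_set_at update_update.
by apply: eq_bigr => k uk; rewrite restrict_set_at_out.
Qed.

(** By [sum_set_at] the mean can be summed first over the value at u. There the screened weight is
    constant and the centered function sums to zero. *)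
Lemma gibbs_mean_screened_gradient (k : factors_at M u) :
  gibbs_mean (fun s => centered (restrict_to (val k) s) *
                       expR (- local_energy (theta_star_at M u) s)) = 0.
Proof.
apply: (mulfI alphabet_card_neq0); rewrite mulr0 /gibbs_mean -sum_set_at.
apply: big1 => s _.
have screenedE (a : alphabet M u) : gibbs (set_at s a) *
      expR (- local_energy (theta_star_at M u) (set_at s a)) =
    gibbs s * expR (- local_energy (theta_star_at M u) s).
  by rewrite /gibbs [LHS]mulrAC [RHS]mulrAC weight_screened_set_at.
under eq_bigr do rewrite mulrCA screenedE.
by rewrite -mulr_suml sum_centered_set_at mul0r.
Qed.

Lemma local_energy_le (s : config M) :
  `|local_energy (theta_star_at M u) s| <= interaction_strength M.
Proof.
apply: (bigmax_sup u) => //; apply: (bigmax_sup s) => //.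
by rewrite /local_energy; under eq_bigr do rewrite ffunE.
Qed.

End Gibbs.

(** * Curvature of the screening objective *)

Section EmpiricalMean.
Context {R : realType} {S : Type} (n : nat) (b : 'I_n -> S).
Implicit Types f g : S -> R.

Lemma empirical_meanD f g :
  empirical_mean b (fun s => f s + g s) = empirical_mean b f + empirical_mean b g.
Proof. by rewrite /empirical_mean big_split mulrDr. Qed.

Lemma empirical_meanZ a f :
  empirical_mean b (fun s => a * f s) = a * empirical_mean b f.
Proof. by rewrite /empirical_mean -mulr_sumr mulrCA. Qed.

Lemma empirical_mean_sum (I : finType) (F : I -> S -> R) :
  empirical_mean b (fun s => \sum_i F i s) = \sum_i empirical_mean b (F i).
Proof. by rewrite /empirical_mean exchange_big mulr_sumr. Qed.

Lemma empirical_mean_le f g :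
  (forall s, f s <= g s) -> empirical_mean b f <= empirical_mean b g.
Proof. by move=> fg; rewrite ler_wpM2l// ler_sum. Qed.

End EmpiricalMean.

Section Screening.
Context {R : realType} {p : nat} (M : graphical_model R p) (u : 'I_p).
Hypothesis M_normalized : normalized M.

Local Notation theta := (theta_star_at M u).
Local Notation gamma := (interaction_strength M).
Local Notation vec := {ffun factors_at M u -> R^o}.

Let g (k : factors_at M u) (s : config M) : R := centered (restrict_to (val k) s).

Let g_le1 k s : `|g k s| <= 1. Proof. exact: M_normalized. Qed.

Lemma local_energyB (x y : vec) (s : config M) :
  local_energy (x - y) s = local_energy x s - local_energy y s.
Proof.
rewrite /local_energy -sumrB; apply: eq_bigr => k _.
by rewrite !ffunE mulrBl.
Qed.

Lemma local_energy_le_norm1 (x : vec) (s : config M) :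
  `|local_energy x s| <= norm1 x.
Proof.
apply: le_trans (ler_norm_sum _ _ _) _; apply: ler_sum => k _.
by rewrite normrM ler_piMr.
Qed.

Lemma norm1B (I : finType) (x y : {ffun I -> R^o}) :
  norm1 (x - y) <= norm1 x + norm1 y.
Proof.
rewrite /norm1 -big_split /=; apply: ler_sum => k _.
by rewrite !ffunE ler_normB.
Qed.

(** The subtracted sum is minus the first-order term at [theta]. The remainder is bounded sample by
    sample with [expRN_taylor_ge], where |z| <= c controls the denominator and e^(- gamma) bounds
    the factor e^(- E_0) from below. *)
Lemma GISO_restricted_strong_convexity (n : nat) (smp : 'I_n -> config M)
    (x : vec) (c : R) : norm1 (x - theta) <= c ->
  expR (- gamma) / (2 + c) *
    empirical_mean smp (fun s => local_energy (x - theta) s ^+ 2) -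
  \sum_(k : factors_at M u) (x - theta) k *
    empirical_mean smp (fun s => g k s * expR (- local_energy theta s)) <=
  GISO smp x - GISO smp theta.
Proof.
move=> xc; have c0 : 0 <= c by apply: le_trans xc; exact: sumr_ge0.
have pointwise s :
    expR (- gamma) / (2 + c) * local_energy (x - theta) s ^+ 2 +
      expR (- local_energy theta s) <=
    expR (- local_energy x s) +
      local_energy (x - theta) s * expR (- local_energy theta s).
  set z := local_energy (x - theta) s.
  have -> : expR (- local_energy x s) = expR (- local_energy theta s) * expR (- z).
    by rewrite -expRD /z local_energyB; congr expR; ring.
  have Egamma : expR (- gamma) <= expR (- local_energy theta s).
    rewrite ler_expR lerN2; apply: le_trans (ler_norm _) _.
    exact: local_energy_le.
  have zc : z ^+ 2 / (2 + c) <= z ^+ 2 / (2 + `|z|).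
    have zle := le_trans (local_energy_le_norm1 (x - theta) s) xc.
    rewrite ler_wpM2l ?sqr_ge0// lef_pV2 ?posrE ?lerD2l//.
    by rewrite ltr_pwDl.
  have := le_trans zc (expRN_taylor_ge z).
  have := expR_ge0 (- gamma).
  have z2 : 0 <= z ^+ 2 / (2 + c) by rewrite divr_ge0 ?sqr_ge0//; lra.
  move: z2 Egamma; rewrite -mulrA [(2 + c)^-1 * _]mulrC.
  by have := expR_gt0 (- local_energy theta s); nra.
have := empirical_mean_le smp pointwise.
rewrite !empirical_meanD empirical_meanZ.
have -> : empirical_mean smp (fun s =>
      local_energy (x - theta) s * expR (- local_energy theta s)) =
    \sum_(k : factors_at M u) (x - theta) k *
      empirical_mean smp (fun s => g k s * expR (- local_energy theta s)).
  under [RHS]eq_bigr do rewrite -empirical_meanZ.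
  rewrite -empirical_mean_sum; congr empirical_mean; apply/funext => s.
  by rewrite mulr_suml; apply: eq_bigr => k _; rewrite mulrA.
rewrite -[empirical_mean smp (fun s => expR (- local_energy x s))]/(GISO smp x).
rewrite -[empirical_mean smp (fun s => expR (- local_energy theta s))]/(GISO smp theta).
lra.
Qed.

(** Both second moments are quadratic forms in [x]. Their matrices differ entrywise by at most e, so
    the forms differ by at most e times the squared l1 norm. *)
Lemma energy_variance_concentration (n : nat) (smp : 'I_n -> config M) (x : vec)
    (e : R) :
    (forall k l, `|empirical_mean smp (fun s => g k s * g l s) -
                   gibbs_mean (fun s => g k s * g l s)| <= e) ->
  gibbs_mean (fun s => local_energy x s ^+ 2) - e * norm1 x ^+ 2 <=
  empirical_mean smp (fun s => local_energy x s ^+ 2).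
Proof.
move=> he.
have sqE s : local_energy x s ^+ 2 =
    \sum_(k : factors_at M u) \sum_(l : factors_at M u)
      x k * x l * (g k s * g l s).
  rewrite expr2 big_distrlr /=; apply: eq_bigr => k _; apply: eq_bigr => l _.
  by rewrite mulrACA.
have -> : empirical_mean smp (fun s => local_energy x s ^+ 2) =
    \sum_(k : factors_at M u) \sum_(l : factors_at M u)
      x k * x l * empirical_mean smp (fun s => g k s * g l s).
  under eq_fun do rewrite sqE.
  rewrite empirical_mean_sum; apply: eq_bigr => k _.
  rewrite empirical_mean_sum; apply: eq_bigr => l _.
  by rewrite empirical_meanZ.
have -> : gibbs_mean (fun s => local_energy x s ^+ 2) =
    \sum_(k : factors_at M u) \sum_(l : factors_at M u)
      x k * x l * gibbs_mean (fun s => g k s * g l s).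
  rewrite /gibbs_mean; under eq_bigr do rewrite sqE mulr_sumr.
  rewrite exchange_big; apply: eq_bigr => k _.
  under eq_bigr do rewrite mulr_sumr.
  rewrite exchange_big; apply: eq_bigr => l _ /=.
  by rewrite mulr_sumr; apply: eq_bigr => s _; rewrite mulrCA.
rewrite lerBlDl -lerBlDr expr2 big_distrlr /= mulr_sumr -sumrB.
apply: ler_sum => k _; rewrite mulr_sumr -sumrB.
apply: ler_sum => l _; rewrite -mulrBr.
apply: le_trans (ler_norm _) _; rewrite !normrM distrC mulrC.
by rewrite ler_wpM2r// mulr_ge0.
Qed.

(** As [theta] is feasible, the objective at [x] exceeds that at [theta] by at most eps. Strong
    convexity with c = 2 ghat, the l1 radius of the perturbations, turns this into a bound on the
    empirical second moment. *)
Lemma eps_minimizer_bound (n : nat) (smp : 'I_n -> config M)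
    (ghat : R) (Y : set vec) (eps : R) (x : vec) (e1 e2 : R) :
    Y theta -> norm1 theta <= ghat -> eps_minimizer smp ghat Y eps x ->
    (forall k, `|empirical_mean smp
       (fun s => g k s * expR (- local_energy theta s))| <= e1) ->
    (forall k l, `|empirical_mean smp (fun s => g k s * g l s) -
                   gibbs_mean (fun s => g k s * g l s)| <= e2) ->
    0 <= e1 -> 0 <= e2 ->
  gibbs_mean (fun s => local_energy (x - theta) s ^+ 2) <=
  4 * e2 * ghat ^+ 2 + 2 * (1 + ghat) * expR gamma * (eps + 2 * ghat * e1).
Proof.
move=> Yt tghat [Yx xghat xmin] he1 he2 e1_ge0 e2_ge0.
have dghat : norm1 (x - theta) <= 2 * ghat.
  by apply: le_trans (norm1B _ _) _; lra.
have ghat0 : 0 <= ghat by apply: le_trans xghat; exact: sumr_ge0.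
have d0 : 0 <= norm1 (x - theta) by exact: sumr_ge0.
have grad : \sum_(k : factors_at M u) (x - theta) k *
    empirical_mean smp (fun s => g k s * expR (- local_energy theta s)) <=
    2 * ghat * e1.
  apply: le_trans (_ : norm1 (x - theta) * e1 <= _); last by rewrite ler_wpM2r.
  rewrite /norm1 mulr_suml; apply: ler_sum => k _.
  by apply: le_trans (ler_norm _) _; rewrite normrM ler_wpM2l.
have var := energy_variance_concentration (x - theta) he2.
have {}var : gibbs_mean (fun s => local_energy (x - theta) s ^+ 2) -
    4 * e2 * ghat ^+ 2 <=
    empirical_mean smp (fun s => local_energy (x - theta) s ^+ 2).
  have d2 : norm1 (x - theta) ^+ 2 <= (2 * ghat) ^+ 2.
    by rewrite lerXn2r// nnegrE// (le_trans d0).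
  by have := ler_wpM2l e2_ge0 d2; lra.
have conv := GISO_restricted_strong_convexity smp dghat.
have xle := xmin _ Yt tghat.
set V := empirical_mean _ _ in var conv.
have Vle : expR (- gamma) / (2 + 2 * ghat) * V <= eps + 2 * ghat * e1 by lra.
rewrite -lerBlDl; apply: le_trans var _.
(* The prefactor is the inverse of the curvature constant. *)
have -> : V = 2 * (1 + ghat) * expR gamma *
    (expR (- gamma) / (2 + 2 * ghat) * V).
  by rewrite expRN; field; rewrite !gt_eqF ?expR_gt0//; lra.
by rewrite ler_wpM2l// mulr_ge0 ?expR_ge0//; lra.
Qed.

End Screening.

(** * Sample complexity *)

(* Deviations are measured relative to the range of each statistic, so one
   relative accuracy [e = rho alpha^2 e^(-2 gamma) / (64 ghat (1 + ghat))]
   serves the gradient entries (range [e^gamma]) and the products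
   [g_k g_l] (range [1]) alike. *)
Definition screening_statistic {R : realType} {p : nat} (M : graphical_model R p)
    (u : 'I_p) (i : factors_at M u + factors_at M u * factors_at M u)
    (s : config M) : R :=
  match i with
  | inl k => centered (restrict_to (val k) s) *
             expR (- local_energy (theta_star_at M u) s)
  | inr kl => centered (restrict_to (val kl.1) s) *
              centered (restrict_to (val kl.2) s)
  end.

Definition statistic_range {R : realType} {p : nat} (M : graphical_model R p)
    (u : 'I_p) (i : factors_at M u + factors_at M u * factors_at M u) : R :=
  if i is inl _ then expR (interaction_strength M) else 1.

Lemma screening_statistic_le (R : realType) (p : nat) (M : graphical_model R p)
    (u : 'I_p) (i : factors_at M u + factors_at M u * factors_at M u)
    (s : config M) : normalized M ->
  `|screening_statistic i s| <= statistic_range i.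
Proof.
move=> nM; case: i => [k|[k l]] /=; rewrite normrM.
  rewrite -[leRHS]mul1r ler_pM// ?nM// ger0_norm ?expR_ge0// ler_expR.
  by have := local_energy_le u s; rewrite ler_norml => /andP[? _]; lra.
by rewrite mulr_ile1.
Qed.

Definition relative_accuracy {R : realType} (ghat rho alpha gamma : R) : R :=
  rho * alpha ^+ 2 * expR (- gamma) ^+ 2 / (64 * (ghat * (1 + ghat))).

Lemma relative_accuracy_gt0 (R : realType) (ghat rho alpha gamma : R) :
  0 < ghat -> 0 < rho -> 0 < alpha -> 0 < relative_accuracy ghat rho alpha gamma.
Proof.
move=> ghat0 rho0 alpha0.
by rewrite divr_gt0 ?mulr_gt0 ?exprn_gt0 ?expR_gt0//; lra.
Qed.

(** In units of rho alpha^2, the second-moment error costs at most 1/16, the optimization tolerance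
    1/10 and the gradient error 1/16; the total 9/40 is below 1/4. *)
Lemma accuracy_budget (R : realType) (ghat rho alpha gamma : R) :
    0 < ghat -> 0 < rho -> 0 < alpha -> 0 <= gamma ->
  4 * relative_accuracy ghat rho alpha gamma * ghat ^+ 2 +
  2 * (1 + ghat) * expR gamma *
    (rho * alpha ^+ 2 * expR (- gamma) / (20 * (1 + ghat)) +
     2 * ghat * (expR gamma * relative_accuracy ghat rho alpha gamma)) <=
  rho * (alpha / 2) ^+ 2.
Proof.
move=> ghat0 rho0 alpha0 gamma0; set e := relative_accuracy _ _ _ _.
have E0 := expR_gt0 gamma.
have e_sq : e * expR gamma ^+ 2 = rho * alpha ^+ 2 / (64 * (ghat * (1 + ghat))).
  rewrite /e /relative_accuracy expRN; field; rewrite !gt_eqF//; lra.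
have first : 4 * e * ghat ^+ 2 <= rho * alpha ^+ 2 / 16.
  have -> : 4 * e * ghat ^+ 2 =
      rho * alpha ^+ 2 / 16 * (expR (- gamma) ^+ 2 * (ghat / (1 + ghat))).
    rewrite /e /relative_accuracy; field; rewrite !gt_eqF//; lra.
  rewrite ler_piMr//; first by rewrite divr_ge0 ?mulr_ge0 ?sqr_ge0 ?ltW.
  rewrite mulr_ile1 ?sqr_ge0 ?exprn_ile1 ?expR_ge0//.
  - by rewrite divr_ge0//; lra.
  - by rewrite expR_le1; lra.
  - by rewrite ler_pdivrMr; lra.
have second : 2 * (1 + ghat) * expR gamma *
    (rho * alpha ^+ 2 * expR (- gamma) / (20 * (1 + ghat))) = rho * alpha ^+ 2 / 10.
  rewrite expRN; field; rewrite !gt_eqF//; lra.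
have third : 2 * (1 + ghat) * expR gamma * (2 * ghat * (expR gamma * e)) =
    rho * alpha ^+ 2 / 16.
  transitivity (4 * (ghat * (1 + ghat)) * (e * expR gamma ^+ 2)); first by ring.
  rewrite e_sq; field; rewrite !gt_eqF//; lra.
rewrite mulrDr second third.
have : 0 <= rho * alpha ^+ 2 by rewrite mulr_ge0 ?sqr_ge0// ltW.
lra.
Qed.

(** Equality holds at the smallest admissible n: the constant 2^14 is 4 * 64^2, with 64 from
    [relative_accuracy]. *)
Lemma sample_size_exponent (R : realType) (ghat rho alpha gamma L n : R) :
    0 < ghat -> 0 < rho -> 0 < alpha ->
    2 ^+ 14 * (ghat ^+ 2 * (1 + ghat) ^+ 2 * expR (4 * gamma) /
               (alpha ^+ 4 * rho ^+ 2)) * L <= n ->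
  2 * L <= n * relative_accuracy ghat rho alpha gamma ^+ 2 / 2.
Proof.
move=> ghat0 rho0 alpha0 hn; set e := relative_accuracy _ _ _ _.
have e0 : 0 < e by exact: relative_accuracy_gt0.
have -> : n * e ^+ 2 / 2 = e ^+ 2 / 2 * n by ring.
rewrite -ler_pdivrMl ?divr_gt0 ?exprn_gt0//; apply: le_trans hn.
rewrite le_eqVlt; apply/orP; left; apply/eqP.
have -> : expR (4 * gamma) = expR gamma ^+ 4 by rewrite expRM_natl.
rewrite /e /relative_accuracy expRN; field; rewrite !gt_eqF ?expR_gt0//; lra.
Qed.

(** The deterministic half of the argument: concentration of all statistics on a fixed sample
    already forces the error bound, for all eps and all minimizers at once. *)
Lemma eps_minimizer_error (R : realType) (p : nat) (M : graphical_model R p)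
    (u : 'I_p) (T : {set factors_at M u})
    (N : {ffun {k : factors_at M u | k \in T} -> R^o} -> R)
    (ghat : R) (Y : set {ffun factors_at M u -> R^o})
    (rho alpha : R) (n : nat) (smp : 'I_n -> config M) :
    normalized M -> norm1 (theta_star_at M u) <= ghat -> Y (theta_star_at M u) ->
    (forall x, perturbation_set ghat Y x ->
       rho * N (subvec T x) ^+ 2 <= gibbs_mean (fun s => local_energy x s ^+ 2)) ->
    0 < ghat -> 0 < rho -> 0 < alpha ->
    (forall i : factors_at M u + factors_at M u * factors_at M u,
      `|empirical_mean smp (screening_statistic i) -
        gibbs_mean (screening_statistic i)| <=
      statistic_range i *
      relative_accuracy ghat rho alpha (interaction_strength M)) ->
  forall (eps : R) (x : {ffun factors_at M u -> R^o}),
    eps <= rho * alpha ^+ 2 * expR (- interaction_strength M) /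
           (20 * (1 + ghat)) ->
    eps_minimizer smp ghat Y eps x ->
    N (subvec T x - subvec T (theta_star_at M u)) <= alpha / 2.
Proof.
move=> nM tghat Yt learn ghat0 rho0 alpha0 conc eps x heps xmin.
set gamma := interaction_strength M in heps conc.
have gamma0 : 0 <= gamma by exact: bigmax_ge_id.
set e := relative_accuracy ghat rho alpha gamma in conc.
have e0 : 0 < e by exact: relative_accuracy_gt0.
have grad (k : factors_at M u) :
    `|empirical_mean smp (fun s => centered (restrict_to (val k) s) *
      expR (- local_energy (theta_star_at M u) s))| <= expR gamma * e.
  have := conc (inl k).
  by rewrite /screening_statistic gibbs_mean_screened_gradient subr0.
have cov (k l : factors_at M u) :
    `|empirical_mean smp (fun s => centered (restrict_to (val k) s) *
      centered (restrict_to (val l) s)) -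
    gibbs_mean (fun s => centered (restrict_to (val k) s) *
      centered (restrict_to (val l) s))| <= e.
  by have := conc (inr (k, l)); rewrite /= mul1r.
have Ee0 : 0 <= expR gamma * e by rewrite mulr_ge0 ?expR_ge0// ltW.
have bound := eps_minimizer_bound nM Yt tghat xmin grad cov Ee0 (ltW e0).
have -> : subvec T x - subvec T (theta_star_at M u) =
    subvec T (x - theta_star_at M u).
  by apply/ffunP => k; rewrite !ffunE.
have pert : perturbation_set ghat Y (x - theta_star_at M u).
  by case: xmin => Yx xghat _; exists x, (theta_star_at M u).
have {learn}bound := le_trans (learn _ pert) bound.
have : rho * N (subvec T (x - theta_star_at M u)) ^+ 2 <= rho * (alpha / 2) ^+ 2.
  apply: le_trans (accuracy_budget ghat0 rho0 alpha0 gamma0).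
  apply: le_trans bound _; rewrite lerD2l ler_wpM2l ?lerD2r//.
  by rewrite mulr_ge0 ?expR_ge0//; lra.
rewrite ler_pM2l//; apply: contraTT; rewrite -!ltNge => alphaN.
by rewrite ltrXn2r//; lra.
Qed.

Theorem theorem1 (R : realType) (p : nat) (M : graphical_model R p)
    (hnormalized : normalized M)
    (u : 'I_p) (T : {set factors_at M u})
    (N : {ffun {k : factors_at M u | k \in T} -> R^o} -> R) (hN : is_norm N)
    (ghat : R) (hghat : 0 < ghat)
    (Y : set {ffun factors_at M u -> R^o})
    (hstar1 : norm1 (theta_star_at M u) <= ghat)
    (hstarY : Y (theta_star_at M u))
    (rho : R) (hrho : 0 < rho)
    (hlearn : forall x, perturbation_set ghat Y x ->
       rho * N (subvec T x) ^+ 2 <=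
       gibbs_mean (fun s => local_energy x s ^+ 2))
    (alpha : R) (halpha : 0 < alpha)
    (delta : R) (hdelta0 : 0 < delta) (hdelta1 : delta < 1)
    (d : measure_display) (Omega : measurableType d) (P : probability Omega R)
    (n : nat) (X : 'I_n -> Omega -> config M) (hX : iid_samples P X)
    (hn : 2 ^+ 14 *
          (ghat ^+ 2 * (1 + ghat) ^+ 2 * expR (4 * interaction_strength M) /
           (alpha ^+ 4 * rho ^+ 2)) *
          ln (4 * #|{: factors_at M u}|%:R ^+ 2 / delta) <= n%:R) :
  ((1 - delta)%:E <=
   P [set w | (forall (eps : R) (x : {ffun factors_at M u -> R^o}),
        eps <= rho * alpha ^+ 2 * expR (- interaction_strength M) /
               (20 * (1 + ghat)) ->
        eps_minimizer (X ^~ w) ghat Y eps x ->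
        N (subvec T x - subvec T (theta_star_at M u)) <= alpha / 2)%R])%E.
Proof.
(* Without factors at u the logarithm has argument 0, so this case is separate. The difference is
   then the zero vector, written as a multiple by 0 so that homogeneity of [N] applies. *)
have [K0|Kpos] := posnP #|{: factors_at M u}|.
  have noK (k : factors_at M u) : False by have := card0_eq K0 k; rewrite inE.
  rewrite [X in P X](_ : _ = setT); last first.
    apply/seteqP; split => // w _ eps x _ _.
    have -> : subvec T x - subvec T (theta_star_at M u) =
        0 *: subvec T (theta_star_at M u).
      by apply/ffunP => -[k]; case: (noK k).
    by case: hN => _ -> _; rewrite normr0 mul0r divr_ge0// ltW.
  by rewrite probability_setT lee_fin gerBl ltW.
set K := #|{: factors_at M u}| in hn Kpos.
set gamma := interaction_strength M in hn *.
set L := ln _ in hn.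
have K1 : 1 <= K%:R :> R by rewrite ler1n.
have K2 : 1 <= K%:R ^+ 2 :> R by rewrite exprn_ege1.
have arg_gt1 : 1 < 4 * K%:R ^+ 2 / delta.
  by rewrite ltr_pdivlMr// mul1r; lra.
have L0 : 0 < L by exact: ln_gt0.
pose e := relative_accuracy ghat rho alpha gamma.
have e0 : 0 < e by exact: relative_accuracy_gt0.
have n_exponent : 2 * L <= n%:R * e ^+ 2 / 2 by exact: sample_size_exponent.
have n0 : (0 < n)%N.
  rewrite lt0n; apply/eqP => n0; move: n_exponent.
  by rewrite n0 mulr0n !mul0r; lra.
rewrite (prob_iid_samples (fun smp => forall (eps : R)
  (x : {ffun factors_at M u -> R^o}),
    eps <= rho * alpha ^+ 2 * expR (- gamma) / (20 * (1 + ghat)) ->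
    eps_minimizer smp ghat Y eps x ->
    N (subvec T x - subvec T (theta_star_at M u)) <= alpha / 2) hX) lee_fin.
pose I := (factors_at M u + factors_at M u * factors_at M u)%type.
pose bad (b : {ffun 'I_n -> config M}) := [exists i : I,
  statistic_range i * e < `|empirical_mean b (screening_statistic i) -
                            gibbs_mean (screening_statistic i)|].
have prob_ge0 (b : {ffun 'I_n -> config M}) : 0 <= \prod_(t < n) gibbs (b t).
  by apply: prodr_ge0 => t _; exact: gibbs_ge0.
have prob_sum : \sum_(b : {ffun 'I_n -> config M}) \prod_(t < n) gibbs (b t) = 1.
  by rewrite -(bigA_distr_bigA (fun=> @gibbs R p M)) /= prodr_const sum_gibbs expr1n.
have range_gt0 (i : I) : 0 < statistic_range i.
  by case: i => [k|kl] /=; rewrite ?expR_gt0.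
have bad_le : \sum_(b | bad b) \prod_(t < n) gibbs (b t) <= delta.
  have := hoeffding_union (@gibbs_ge0 R p M) (sum_gibbs M) n0 range_gt0
    (fun i s => screening_statistic_le i s hnormalized) (ltW e0).
  move=> /le_trans; apply.
  (* The right side is e^(- L). *)
  have expL : expR (- (n%:R * e ^+ 2 / 2)) <= delta / (4 * K%:R ^+ 2).
    rewrite -[leRHS]invf_div -[_ / delta]lnK ?posrE; last lra.
    by rewrite -expRN ler_expR lerN2 -/L; lra.
  have cardI : #|{: I}|%:R = K%:R + K%:R ^+ 2 :> R.
    by rewrite card_sum card_prod natrD natrM expr2.
  (* There are K + K^2 <= 2 K^2 statistics, which with the two tails accounts for the factor 4 K^2
     in the logarithm. *)
  apply: (@le_trans _ _ (2 * K%:R ^+ 2 * (2 * (delta / (4 * K%:R ^+ 2))))).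
    rewrite cardI ler_pM ?mulr_ge0 ?expR_ge0 ?addr_ge0 ?ler_wpM2l//.
    by have : K%:R <= K%:R ^+ 2 :> R; [rewrite expr2 ler_peMr | lra].
  rewrite le_eqVlt; apply/orP; left; apply/eqP; field.
  by rewrite gt_eqF; lra.
(* The total mass 1 splits into bad samples, of mass at most delta, and good samples, which all lie
   in the target event. *)
rewrite lerBlDr -[leLHS]prob_sum (bigID bad) /= [leLHS]addrC.
apply: lerD bad_le.
rewrite [leLHS]big_mkcond [leRHS]big_mkcond /=; apply: ler_sum => b _.
case: ifPn => [good|_]; last by case: ifP.
rewrite ifT//; apply/asboolP.
apply: eps_minimizer_error => // i.
by rewrite leNgt; move: good; rewrite negb_exists => /forallP.
Qed.
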